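(* Let $q>5$. In $\mathrm{PG}(2,q^2)$ let $\mathcal B$ be a Baer subplane tangent to $\ell_\infty$ and $\mathcal C$ an $\mathbb F_q$-conic in $\mathcal B$ containing the point $\bar T=\mathcal B\cap\ell_\infty$. Then in $\mathrm{PG}(4,q)$, $[\mathcal C]$ is a $g$-special twisted cubic.
   Context: Bruck–Bose setting: $\Sigma_\infty$ a hyperplane of $\mathrm{PG}(4,q)$ with regular spread $\mathcal S$; affine points $A$ of $\mathrm{PG}(2,q^2)$ correspond to points $[A]$ of $\mathrm{PG}(4,q)\setminus\Sigma_\infty$, points $\bar T\in\ell_\infty$ to spread lines $[T]$, lines $\ne\ell_\infty$ to planes not in $\Sigma_\infty$ containing a spread line. In $\mathrm{PG}(4,q^2)$ the transversals of $\mathcal S$ are the conjugate lines $g,g^q$ (conjugation $X\mapsto X^q$ of coordinates) with $[T]^\star=TT^q$ where $T=[T]^\star\cap g$. An $\mathbb F_q$-conic is a non-degenerate conic of a Baer subplane of $\mathrm{PG}(2,q^2)$. It is known that for $\mathcal B$ tangent to $\ell_\infty$ at $\bar T$ and $\mathcal C$ an $\mathbb F_q$-conic of $\mathcal B$ through $\bar T$, the set $\{[X]: X\in\mathcal C\text{ affine}\}$ together with one point of $[T]$ is a twisted cubic (a $3$-dimensional normal rational curve spanning a $3$-space) of $\mathrm{PG}(4,q)$; this twisted cubic is denoted $[\mathcal C]$. Its extension $[\mathcal C]^\star$ to $\mathrm{PG}(4,q^2)$ is obtained by extending the parameter field to $\mathbb F_{q^2}$. A twisted cubic $\mathcal N$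 of $\mathrm{PG}(4,q)$ is $g$-special if $\mathcal N^\star$ contains one point of $g$ and one point of $g^q$. *)

(* Defs.v *)
(* Coordinates of the Bruck--Bose setting, all inside
   PG(n,q^2) with PG(n,q) seen as the F_q-rational points. *)
From HB Require Import structures.
From mathcomp Require Import all_boot all_order all_algebra all_field.
Set Implicit Arguments. Unset Strict Implicit. Unset Printing Implicit Defensive.
Import GRing.Theory.
Local Open Scope ring_scope.

Section BruckBose.
Variables (L : finFieldType) (q : nat) (tau : L).

Definition inFq (x : L) : bool := x ^+ q == x.
Definition Fq_mx m n (A : 'M[L]_(m, n)) : bool := [forall i, forall j, inFq (A i j)].

(* projective points: nonzero row vectors up to scalars; (P == Q)%MS is
   equality of points. *)

Definition on_linf (P : 'rV[L]_3) : bool := (P != 0) && (P ord0 (inord 2) == 0).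
Definition affine (P : 'rV[L]_3) : bool := P ord0 (inord 2) != 0.

(* Baer subplane B_M = image of PG(2,q) under the projectivity M (M invertible) *)
Definition baer_pt (M : 'M[L]_3) (P : 'rV[L]_3) : Prop :=
  P != 0 /\ exists v : 'rV[L]_3, Fq_mx v /\ (v *m M == P)%MS.

Definition baer_tangent_at (M : 'M[L]_3) (T : 'rV[L]_3) : Prop :=
  baer_pt M T /\ on_linf T /\
  forall P, baer_pt M P -> on_linf P -> (P == T)%MS.

Definition kc (k : 'rV[L]_6) (i : nat) : L := k ord0 (inord i).
Definition Qform (k : 'rV[L]_6) (v : 'rV[L]_3) : L :=
  let x := v ord0 (inord 0) in let y := v ord0 (inord 1) in
  let z := v ord0 (inord 2) in
  kc k 0 * x ^+ 2 + kc k 1 * y ^+ 2 + kc k 2 * z ^+ 2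
  + kc k 3 * y * z + kc k 4 * x * z + kc k 5 * x * y.
(* non-degeneracy (characteristic free): 4abc + fgh - af^2 - bg^2 - ch^2 <> 0
   (= half the determinant of the associated symmetric matrix) *)
Definition qdisc (k : 'rV[L]_6) : L :=
  4%:R * kc k 0 * kc k 1 * kc k 2 + kc k 3 * kc k 4 * kc k 5
  - kc k 0 * kc k 3 ^+ 2 - kc k 1 * kc k 4 ^+ 2 - kc k 2 * kc k 5 ^+ 2.
Definition nondeg_Fq_form (k : 'rV[L]_6) : Prop := Fq_mx k /\ qdisc k != 0.

Definition conic_pt (M : 'M[L]_3) (k : 'rV[L]_6) (P : 'rV[L]_3) : Prop :=
  P != 0 /\ exists v : 'rV[L]_3, Fq_mx v /\ Qform k v = 0 /\ (v *m M == P)%MS.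

(* F_q-coordinates of x in the basis {1, tau}: x = c0 x + c1 x * tau *)
Definition c1 (x : L) : L := (x - x ^+ q) / (tau - tau ^+ q).
Definition c0 (x : L) : L := (tau * x ^+ q - tau ^+ q * x) / (tau - tau ^+ q).

Definition vec5 (a b c d e : L) : 'rV[L]_5 :=
  \row_(i < 5) nth 0 [:: a; b; c; d; e] i.

Definition bb_aff (P : 'rV[L]_3) : 'rV[L]_5 :=
  let x := P ord0 (inord 0) / P ord0 (inord 2) in
  let y := P ord0 (inord 1) / P ord0 (inord 2) in
  vec5 (c0 x) (c1 x) (c0 y) (c1 y) 1.

(* the point of Sigma_infty (x4 = 0) associated with the vector (x,y) of L^2 *)
Definition bbdir (x y : L) : 'rV[L]_5 := vec5 (c0 x) (c1 x) (c0 y) (c1 y) 0.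

Definition spread_pt (T : 'rV[L]_3) (P : 'rV[L]_5) : Prop :=
  P != 0 /\ exists lam : L, lam != 0 /\
    (P == bbdir ((lam * T ord0 (inord 0))%R) ((lam * T ord0 (inord 1))%R))%MS.

(* [T]^*: the extension of [T] to PG(4,q^2) (span of two F_q-points of [T]) *)
Definition spread_mx (T : 'rV[L]_3) : 'M[L]_(1 + 1, 5) :=
  col_mx (bbdir (T ord0 (inord 0)) (T ord0 (inord 1)))
         (bbdir (tau * T ord0 (inord 0)) (tau * T ord0 (inord 1))).

Definition spread_transversal (G : 'M[L]_(2, 5)) : Prop :=
  \rank G = 2%N /\
  forall T : 'rV[L]_3, on_linf T -> (G :&: spread_mx T)%MS != 0.

Definition conjq m n (A : 'M[L]_(m, n)) : 'M[L]_(m, n) := map_mx (fun x => x ^+ q) A.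

Definition moment (s t : L) : 'rV[L]_4 :=
  \row_(i < 4) nth 0 [:: s ^+ 3; s ^+ 2 * t; s * t ^+ 2; t ^+ 3] i.

(* A (rows a,b,c,d, F_q-rational and independent) parametrizes the twisted
   cubic  { < s^3 a + s^2 t b + s t^2 c + t^3 d > : (s:t) in PG(1,q) } *)
Definition twisted_cubic_param (A : 'M[L]_(4, 5)) : Prop := Fq_mx A /\ row_free A.

Definition nrc_pt (A : 'M[L]_(4, 5)) (P : 'rV[L]_5) : Prop :=
  P != 0 /\ exists s t : L, inFq s /\ inFq t /\ (moment s t *m A == P)%MS.
Definition nrcx_pt (A : 'M[L]_(4, 5)) (P : 'rV[L]_5) : Prop :=
  P != 0 /\ exists s t : L, (moment s t *m A == P)%MS.

Definition meets_in_one_point (A : 'M[L]_(4, 5)) (G : 'M[L]_(2, 5)) : Prop :=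
  (exists P, nrcx_pt A P /\ (P <= G)%MS) /\
  forall P P', nrcx_pt A P -> (P <= G)%MS -> nrcx_pt A P' -> (P' <= G)%MS ->
    (P == P')%MS.

Definition g_special (A : 'M[L]_(4, 5)) (G : 'M[L]_(2, 5)) : Prop :=
  meets_in_one_point A G /\ meets_in_one_point A (conjq G).

Definition bracket_C_pt (M : 'M[L]_3) (k : 'rV[L]_6) (P0 : 'rV[L]_5)
  (Y : 'rV[L]_5) : Prop :=
  Y != 0 /\
  ((exists X, conic_pt M k X /\ affine X /\ (Y == bb_aff X)%MS) \/ (Y == P0)%MS).

End BruckBose.

(* Main.v *)
Require Import Defs.
From HB Require Import structures.
From mathcomp Require Import all_boot all_order all_algebra all_field ring.
Import GRing.Theory.
Local Open Scope ring_scope.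
Set Implicit Arguments. Unset Strict Implicit. Unset Printing Implicit Defensive.

(** Choose an F_q-basis u0, u1, u2 with u0 the point T of the conic and put
    w = s u1 + t u2. Projection from T parametrizes the conic by
    v(s,t) = Q(w) u0 - B(u0,w) w, B the polar form, and the last coordinate of
    the corresponding point X(s,t) of PG(2,q^2) is - B(u0,w) l, where
    l = alpha s + beta t with alpha, beta independent over F_q because the Baer
    subplane is tangent to l_infty. Scaling X by the conjugate l^q makes the last
    coordinate F_q-rational, so the coordinates (x, x^q, y, y^q, z) of PG(4,q^2)
    become cubic forms: X l^q, its conjugate, and the norm form. These span all
    binary cubics, which gives a twisted cubic. The transversals are
    x^q = y^q = z = 0 and x = y = z = 0, and they meet the extended cubic exactly
    at l = 0 and at l^q = 0. Finally the extension depends only on the F_q-points,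
    since a binary sextic vanishing at q > 6 points is zero. *)

(** * The Frobenius map and the subfield F_q *)

(** [#|L|] is a power of the characteristic, hence so is its square root [q]; this is what makes
    [x ^+ q] additive. *)
Lemma sqrt_card_pchar (L : finFieldType) (q : nat) :
  #|L| = (q ^ 2)%N -> [pchar L].-nat q.
Proof.
move=> cardL; have [p p_pr pL] := finPcharP L.
have Lp : p.-nat #|L| by rewrite (card_pprimeChar pL) pnatX pnat_id.
rewrite (eq_pnat _ (pcharf_eq pL)).
by move: Lp; rewrite cardL pnatX /= orbF.
Qed.

(** The proof about [q] is carried as an argument so that a ring morphism structure can be attached
    to the map. *)
Definition frobq (L : finFieldType) q of [pchar L].-nat q := fun x : L => x ^+ q.

Section FrobeniusMorphism.
Variables (L : finFieldType) (q : nat) (qL : [pchar L].-nat q).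

Lemma frobq_is_zmod_morphism : zmod_morphism (frobq qL).
Proof. by move=> x y; rewrite /frobq exprDn_pchar // exprNn_pchar. Qed.

Lemma frobq_is_monoid_morphism : monoid_morphism (frobq qL).
Proof. by split=> [|x y]; rewrite /frobq ?expr1n ?exprMn. Qed.

HB.instance Definition _ :=
  GRing.isZmodMorphism.Build L L (frobq qL) frobq_is_zmod_morphism.
HB.instance Definition _ :=
  GRing.isMonoidMorphism.Build L L (frobq qL) frobq_is_monoid_morphism.

Definition Fq of [pchar L].-nat q : {pred L} := inFq q.

Lemma FqE x : (x \in Fq qL) = (frobq qL x == x). Proof. by []. Qed.

Lemma Fq_divring_closed : divring_closed (Fq qL).
Proof.
split=> [|x y|x y]; rewrite !FqE ?rmorph1 //.
  move=> /eqP xF /eqP yF; by rewrite rmorphB /= xF yF.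
by move=> /eqP xF /eqP yF; rewrite fmorph_div /= xF yF.
Qed.

HB.instance Definition _ := GRing.isDivringClosed.Build L (Fq qL) Fq_divring_closed.

Lemma frobqK : #|L| = (q ^ 2)%N -> involutive (frobq qL).
Proof. by move=> cardL x; rewrite /frobq -exprM mulnn -cardL expf_card. Qed.

Lemma frobq_Fq x : x \in Fq qL -> frobq qL x = x. Proof. by move/eqP. Qed.

End FrobeniusMorphism.

Section BasisOverFq.
Variables (L : finFieldType) (q : nat) (tau : L).
Hypotheses (cardL : #|L| = (q ^ 2)%N) (tauN : tau ^+ q != tau).
Let qL := sqrt_card_pchar cardL.

Lemma tau_sub_neq0 : tau - tau ^+ q != 0.
Proof. by rewrite subr_eq0 eq_sym. Qed.

Lemma c0_Fq x : c0 q tau x \in Fq qL.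
Proof.
rewrite FqE /c0 -/(frobq qL x) -/(frobq qL tau) fmorph_div !rmorphB !rmorphM.
rewrite /= !(frobqK qL cardL).
by rewrite -[in X in _ / X]opprB -[in X in X / _]opprB mulNr invrN mulrN opprK.
Qed.

Lemma c1_Fq x : c1 q tau x \in Fq qL.
Proof.
rewrite FqE /c1 -/(frobq qL x) -/(frobq qL tau) fmorph_div !rmorphB.
rewrite /= !(frobqK qL cardL).
by rewrite -[in X in _ / X]opprB -[in X in X / _]opprB mulNr invrN mulrN opprK.
Qed.

Lemma c0c1E x : c0 q tau x + tau * c1 q tau x = x.
Proof. by have := tau_sub_neq0; rewrite /c0 /c1; move=> ?; field. Qed.

Lemma c0c1_conjE x : c0 q tau x + tau ^+ q * c1 q tau x = x ^+ q.
Proof. by have := tau_sub_neq0; rewrite /c0 /c1; move=> ?; field. Qed.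

(** The coordinates [c0], [c1] embed [L] into pairs over F_q, so q^2 is at most the square of the
    order of F_q. *)
Lemma leq_card_Fq : (q <= #|Fq qL|)%N.
Proof.
rewrite -leq_sqr -!mulnn -cardX mulnn -cardL.
pose f (x : L) := (c0 q tau x, c1 q tau x).
have finj : injective f.
  by move=> x y [e0 e1]; rewrite -[x]c0c1E e0 e1 c0c1E.
rewrite -(card_codom finj); apply/subset_leq_card/subsetP => _ /codomP[x ->].
by rewrite inE /= c0_Fq c1_Fq.
Qed.

Lemma poly_eq0_Fq (p : {poly L}) :
  (size p <= q)%N -> (forall x, inFq q x -> root p x) -> p = 0.
Proof.
move=> szp rp; apply/eqP/contraT => p0.
have := @max_poly_roots _ p (enum (Fq qL)) p0.
rewrite enum_uniq -cardE => /(_ _ isT) H; suff: (#|Fq qL| < size p)%N.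
  by move=> /(leq_ltn_trans leq_card_Fq); rewrite ltnNge szp.
by apply: H; apply/allP => x; rewrite mem_enum; apply: rp.
Qed.

(* q is a power of the characteristic, so q > 5 forces q >= 7. *)
Lemma q_gt6 : (5 < q)%N -> (6 < q)%N.
Proof.
rewrite leq_eqVlt => /orP[/eqP q6|//]; move: qL; rewrite -q6.
have -> : 6%N = (2 * 3)%N by [].
rewrite pnatM !pnatE // !inE /= => /andP[/eqP two0 /eqP three0].
have one0 : 1 = 3%:R - 2%:R :> L by ring.
by have := oner_neq0 L; rewrite one0 two0 three0 subr0 eqxx.
Qed.

End BasisOverFq.

(** * Coordinates in small dimension and projective points *)

Lemma ord3P (P : 'I_3 -> Prop) :
  P (inord 0) -> P (inord 1) -> P (inord 2) -> forall i, P i.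
Proof.
move=> P0 P1 P2 [[|[|[|//]]] lti];
  [move: P0|move: P1|move: P2]; congr P; apply: val_inj; exact: inordK.
Qed.

Lemma ord4P (P : 'I_4 -> Prop) :
  P (inord 0) -> P (inord 1) -> P (inord 2) -> P (inord 3) -> forall i, P i.
Proof.
move=> P0 P1 P2 P3 [[|[|[|[|//]]]] lti];
  [move: P0|move: P1|move: P2|move: P3]; congr P; apply: val_inj; exact: inordK.
Qed.

Lemma ord5P (P : 'I_5 -> Prop) :
  P (inord 0) -> P (inord 1) -> P (inord 2) -> P (inord 3) -> P (inord 4) ->
  forall i, P i.
Proof.
move=> P0 P1 P2 P3 P4 [[|[|[|[|[|//]]]]] lti];
  [move: P0|move: P1|move: P2|move: P3|move: P4];
  congr P; apply: val_inj; exact: inordK.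
Qed.

Lemma sum_ord3 (V : nmodType) (F : 'I_3 -> V) :
  \sum_i F i = F (inord 0) + F (inord 1) + F (inord 2).
Proof.
rewrite !big_ord_recr big_ord0 /= add0r.
by do ![congr (_ + _)]; congr F; apply: val_inj; rewrite /= inordK.
Qed.

Lemma sum_ord4 (V : nmodType) (F : 'I_4 -> V) :
  \sum_i F i = F (inord 0) + F (inord 1) + F (inord 2) + F (inord 3).
Proof.
rewrite !big_ord_recr big_ord0 /= add0r.
by do ![congr (_ + _)]; congr F; apply: val_inj; rewrite /= inordK.
Qed.

Lemma sum_ord5 (V : nmodType) (F : 'I_5 -> V) :
  \sum_i F i = F (inord 0) + F (inord 1) + F (inord 2) + F (inord 3) + F (inord 4).
Proof.
rewrite !big_ord_recr big_ord0 /= add0r.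
by do ![congr (_ + _)]; congr F; apply: val_inj; rewrite /= inordK.
Qed.

Definition rc {R : Type} {m n} (A : 'M[R]_(m.+1, n.+1)) i j := A (inord i) (inord j).

Lemma rV_eqmxP (F : fieldType) n (u v : 'rV[F]_n) :
  reflect (exists2 c, c != 0 & u = c *: v) (u == v)%MS.
Proof.
apply: (iffP andP) => [[/sub_rVP[a uE] /sub_rVP[b vE]]|[c c0 ->]]; last first.
  by rewrite !eqmx_scale.
have [u0|u0] := eqVneq u 0.
  by exists 1; rewrite ?oner_neq0 // scale1r vE u0 scaler0.
by exists a => //; apply: contraNneq u0 => a0; rewrite uE a0 scale0r.
Qed.

(** * The standard twisted cubic *)

Section Moment.
Variable L : finFieldType.
Implicit Types s t : L.

Lemma moment_eq0 s t : (moment s t == 0) = (s == 0) && (t == 0).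
Proof.
apply/eqP/andP => [m0|[/eqP-> /eqP->]].
  have /rowP/(_ (inord 0)) := m0; have /rowP/(_ (inord 3)) := m0.
  rewrite !mxE !inordK //= => /eqP + /eqP.
  by rewrite !expf_eq0 /= => -> ->.
apply/rowP; apply: ord4P; rewrite !mxE !inordK //=; ring.
Qed.

Lemma momentZ c s t : moment (c * s) (c * t) = c ^+ 3 *: moment s t.
Proof. by apply/rowP; apply: ord4P; rewrite !mxE !inordK //=; ring. Qed.

Lemma row_free_mul_eq0 m n p (A : 'M[L]_(n, p)) (u : 'M[L]_(m, n)) :
  row_free A -> (u *m A == 0) = (u == 0).
Proof.
move=> Afree; apply/eqP/eqP => [uA0|->]; last exact: mul0mx.
by apply: (row_free_inj Afree); rewrite uA0 mul0mx.
Qed.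

(** The three quadrics are the 2 by 2 minors of the matrix with rows (y0, y1, y2) and (y1, y2, y3).
    If y0 = 0 they leave only (0:0:0:1); otherwise the parameter is (y0 : y1), with scalar y0^2. *)
Lemma quadrics_moment (y : 'rV[L]_4) : y != 0 ->
    rc y 0 0 * rc y 0 2 = rc y 0 1 ^+ 2 -> rc y 0 0 * rc y 0 3 = rc y 0 1 * rc y 0 2 ->
    rc y 0 1 * rc y 0 3 = rc y 0 2 ^+ 2 ->
  exists s t, (moment s t == y)%MS.
Proof.
move=> yN0 q02 q03 q13.
have yE i : y 0 i = y (inord 0) i by congr (y _ i); apply: val_inj; rewrite /= inordK.
have [y0|y0] := eqVneq (rc y 0 0) 0.
  have /eqP : rc y 0 1 ^+ 2 = 0 by rewrite -q02 y0 mul0r.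
  rewrite expf_eq0 /= => /eqP y1.
  have /eqP : rc y 0 2 ^+ 2 = 0 by rewrite -q13 y1 mul0r.
  rewrite expf_eq0 /= => /eqP y2.
  have y3 : rc y 0 3 != 0.
    apply: contraNneq yN0 => y3; apply/eqP/rowP.
    by apply: ord4P; rewrite !mxE yE.
  exists 0, 1; apply/rV_eqmxP; exists (rc y 0 3)^-1; rewrite ?invr_eq0 //.
  apply/rowP; apply: ord4P; rewrite !mxE !inordK //= yE -/(rc y 0 _) ?y0 ?y1 ?y2;
    by field.
exists (rc y 0 0), (rc y 0 1); apply/rV_eqmxP; exists (rc y 0 0 ^+ 2).
  by rewrite expf_neq0.
apply/rowP; apply: ord4P; rewrite !mxE !inordK //= yE -/(rc y 0 _); try by ring.
  by rewrite -q02; ring.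
by rewrite exprS -q02 mulrCA -q03; ring.
Qed.

(** Indices are reversed because entry 0 of [moment] carries the highest power of the first
    parameter. *)
Definition cubic_poly (v : 'I_4 -> L) : {poly L} := \poly_(i < 4) v (inord (3 - i)).

Lemma horner_cubic_poly v x : (cubic_poly v).[x] =
  v (inord 0) * x ^+ 3 + v (inord 1) * x ^+ 2 + v (inord 2) * x + v (inord 3).
Proof. by rewrite horner_poly sum_ord4 !inordK //=; ring. Qed.

Lemma cubic_poly_eq0 v : cubic_poly v = 0 -> forall i, v i = 0.
Proof.
move=> p0 i; have := congr1 (fun p : {poly L} => p`_(3 - i)) p0.
rewrite coef0 coef_poly ltnS leq_subr subKn ?leq_ord //.
by rewrite inord_val.
Qed.

Lemma moment1_mulmx n (C : 'M[L]_(4, n)) x j :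
  (moment x 1 *m C) ord0 j = (cubic_poly (C^~ j)).[x].
Proof.
by rewrite horner_cubic_poly !mxE sum_ord4 !mxE !inordK //=; ring.
Qed.

Lemma moment_dehomog s t : t != 0 -> moment s t = t ^+ 3 *: moment (s / t) 1.
Proof. by move=> t0; rewrite -momentZ mulr1 mulrC divfK. Qed.

End Moment.

(** * The extended cubic depends only on the F_q-points *)

Section ExtensionUnique.
Variables (L : finFieldType) (q : nat) (tau : L).
Hypotheses (cardL : #|L| = (q ^ 2)%N) (tauN : tau ^+ q != tau) (q_gt5 : (5 < q)%N).
Let q_gt6 : (6 < q)%N := q_gt6 cardL q_gt5.
Let qL := sqrt_card_pchar cardL.

Lemma inFq0 : inFq q (0 : L). Proof. exact: (rpred0 (Fq qL)). Qed.
Lemma inFq1 : inFq q (1 : L). Proof. exact: (rpred1 (Fq qL)). Qed.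

Lemma nrc_pt_moment (A : 'M[L]_(4, 5)) s t : row_free A ->
  inFq q s -> inFq q t -> moment s t != 0 -> nrc_pt q A (moment s t *m A).
Proof.
move=> Afree sF tF m0; split; first by rewrite row_free_mul_eq0.
by exists s, t; rewrite !submx_refl.
Qed.

(** The F_q-points of the second curve lie in the span of [A], so the columns of [A' *m cokermx A]
    are cubic polynomials vanishing on F_q, hence zero. *)
Lemma nrc_sub_submx (A A' : 'M[L]_(4, 5)) : row_free A' ->
  (forall Y, nrc_pt q A' Y -> nrc_pt q A Y) -> (A' <= A)%MS.
Proof.
move=> A'free sub; rewrite submxE; apply/eqP/matrixP => i j; rewrite [RHS]mxE.
apply: (@cubic_poly_eq0 _ ((A' *m cokermx A)^~ j)).
apply: (poly_eq0_Fq cardL tauN).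
  by rewrite (leq_trans (size_poly _ _)) // (leq_trans _ q_gt6).
move=> x xF; rewrite rootE -moment1_mulmx.
have m0 : moment x 1 != 0 by rewrite moment_eq0 oner_eq0 andbF.
have [_ [s [t [_ [_ /andP[_ mA]]]]]] := sub _ (nrc_pt_moment A'free xF inFq1 m0).
have := submx_trans mA (submxMl _ _); rewrite submxE => /eqP.
by rewrite -mulmxA => ->; rewrite mxE.
Qed.

(* The quadrics through the cubic of A pull back to sextics in the parameter
   of A', which have more than 6 zeros in F_q and hence vanish over L. *)
Lemma nrcx_sub (A A' : 'M[L]_(4, 5)) : row_free A -> row_free A' ->
    (forall Y, nrc_pt q A' Y -> nrc_pt q A Y) ->
  forall Y, nrcx_pt A' Y -> nrcx_pt A Y.
Proof.
move=> Afree A'free sub Y [Y0 [s [t mY]]]; split=> //.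
have /submxP[C A'E] := nrc_sub_submx A'free sub.
have m0 : moment s t != 0.
  apply: contraNneq Y0 => m0; move: mY; rewrite m0 mul0mx => /andP[_].
  by move=> /sub_rVP[c ->]; rewrite scaler0.
have mC0 x y : moment x y != 0 -> moment x y *m C != 0.
  by move=> xy0; rewrite -(row_free_mul_eq0 _ Afree) -mulmxA -A'E row_free_mul_eq0.
have FqP x y : inFq q x -> inFq q y -> moment x y != 0 ->
    exists a b c, moment x y *m C = c *: moment a b.
  move=> xF yF xy0.
  have [_ [a [b [_ [_ mA]]]]] := sub _ (nrc_pt_moment A'free xF yF xy0).
  have /andP[_ /sub_rVP[c]] := mA; rewrite A'E mulmxA scalemxAl.
  by move=> /(row_free_inj Afree) ?; exists a, b, c.
suff [a [b ab]] : exists a b, (moment a b == moment s t *m C)%MS.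
  exists a, b; apply/rV_eqmxP; move/rV_eqmxP: ab mY => [c c0 ->] /rV_eqmxP[d d0].
  by rewrite -scalemxAl -mulmxA -A'E => ->; exists (c * d); rewrite ?mulf_neq0 ?scalerA.
(* The parameter (1:0) is F_q-rational, so [FqP] settles it; all others are reached by evaluating
   polynomials at [s / t]. *)
have [t0|t0] := eqVneq t 0.
  have s0 : s != 0 by move: m0; rewrite moment_eq0 t0 eqxx andbT.
  have sE : moment s t = s ^+ 3 *: moment 1 0 by rewrite -momentZ mulr1 mulr0 t0.
  have m10 : moment 1 0 != 0 :> 'rV[L]_4 by rewrite moment_eq0 oner_eq0.
  have [a [b [c mE]]] := FqP _ _ inFq1 inFq0 m10.
  exists a, b; apply/rV_eqmxP; exists (s ^+ 3 * c)^-1; last first.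
    rewrite sE -scalemxAl mE !scalerA mulVf ?scale1r // mulf_neq0 ?expf_neq0 //.
    by apply: contraNneq (mC0 _ _ m10) => c0; rewrite mE c0 scale0r.
  rewrite invr_eq0 mulf_neq0 ?expf_neq0 //.
  by apply: contraNneq (mC0 _ _ m10) => c0; rewrite mE c0 scale0r.
pose P i := cubic_poly (C^~ (inord i)).
have szP i j : (size (P i * P j)%R <= 7)%N.
  rewrite (leq_trans (size_polyMleq _ _)) //.
  by rewrite -[7%N]/(4 + 4).-1 -!subn1 leq_sub2r // leq_add ?size_poly.
have quadric i j k l : (forall a b : L, rc (moment a b) 0 i * rc (moment a b) 0 j =
     rc (moment a b) 0 k * rc (moment a b) 0 l) -> P i * P j = P k * P l.
  move=> ijkl; apply/eqP; rewrite -subr_eq0; apply/eqP.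
  apply: (poly_eq0_Fq cardL tauN).
    rewrite (leq_trans _ q_gt6) // (leq_trans (size_polyD _ _)) // geq_max size_polyN.
    by rewrite !szP.
  move=> x xF; have x10 : moment x 1 != 0 by rewrite moment_eq0 oner_eq0 andbF.
  have [a [b [c mE]]] := FqP _ _ xF inFq1 x10.
  rewrite rootE !hornerE -!moment1_mulmx mE !mxE -/(rc _ 0 _).
  have := ijkl a b; rewrite /rc !mxE => E.
  by rewrite subr_eq0 !(mulrACA c _ c) E.
have PE i : rc (moment s t *m C) 0 i = t ^+ 3 * (P i).[s / t].
  rewrite -moment1_mulmx moment_dehomog // -scalemxAl /rc mxE; congr (_ * _).
  by congr (_ _ _); apply: val_inj; rewrite /= inordK.
apply: quadrics_moment; rewrite ?mC0 // !PE.
- have /(congr1 (horner^~ (s / t))) := quadric 0%N 2%N 1%N 1%N 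
    (ltac:(move=> a b; rewrite /rc !mxE !inordK //=; ring)).
  by move=> E; rewrite !hornerE in E; rewrite mulrACA E; ring.
- have /(congr1 (horner^~ (s / t))) := quadric 0%N 3%N 1%N 2%N 
    (ltac:(move=> a b; rewrite /rc !mxE !inordK //=; ring)).
  by move=> E; rewrite !hornerE in E; rewrite mulrACA E; ring.
- have /(congr1 (horner^~ (s / t))) := quadric 1%N 3%N 2%N 2%N 
    (ltac:(move=> a b; rewrite /rc !mxE !inordK //=; ring)).
  by move=> E; rewrite !hornerE in E; rewrite mulrACA E; ring.
Qed.

(** Both curves have the same extension by [nrcx_sub] in each direction, and [g_special] sees a
    curve only through its extended points. *)
Lemma g_special_transfer (A A' : 'M[L]_(4, 5)) G : row_free A -> row_free A' ->
    (forall Y, nrc_pt q A Y <-> nrc_pt q A' Y) ->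
  g_special q A G -> g_special q A' G.
Proof.
move=> Afree A'free AA'.
have sub := nrcx_sub A'free Afree (fun Y => proj1 (AA' Y)).
have sub' := nrcx_sub Afree A'free (fun Y => proj2 (AA' Y)).
have one H : meets_in_one_point A H -> meets_in_one_point A' H.
  case=> -[P [nP PH]] uniqP; split; first by exists P; split=> //; apply: sub.
  by move=> R R' /sub' nR RH /sub' nR' R'H; apply: uniqP.
by case=> *; split; apply: one.
Qed.

End ExtensionUnique.

(** * Cubics with a linear factor, and complex readings of PG(4,q^2) *)

Definition row3 (R : nzRingType) (x y z : R) : 'rV[R]_3 :=
  \row_(i < 3) nth 0 [:: x; y; z] i.

Definition quad (R : nzRingType) (s t : R) : 'rV[R]_3 := row3 (s ^+ 2) (s * t) (t ^+ 2).

(* The columns are the coefficients of (x s + y t) s^2, (x s + y t) s t and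
   (x s + y t) t^2. *)
Definition linmul (R : nzRingType) (x y : R) : 'M[R]_(4, 3) :=
  \matrix_(i < 4, j < 3)
    nth 0 (nth [::] [:: [:: x; 0; 0]; [:: y; x; 0]; [:: 0; y; x]; [:: 0; 0; y]] i) j.

Lemma moment_linmul (L : finFieldType) (x y s t : L) :
  moment s t *m linmul x y = (x * s + y * t) *: quad s t.
Proof.
by apply/rowP; apply: ord3P; rewrite !mxE sum_ord4 !mxE !inordK //=; ring.
Qed.

(* Right multiplication by [cplx tau] reads the first two pairs of coordinates
   as elements of F_(q^2) written in the basis {1, tau}. *)
Definition cplx (R : nzRingType) (a : R) : 'M[R]_(5, 3) :=
  \matrix_(i < 5, j < 3)
    nth 0 (nth [::] [:: [:: 1; 0; 0]; [:: a; 0; 0]; [:: 0; 1; 0]; [:: 0; a; 0];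
                        [:: 0; 0; 1]] i) j.

Lemma mul_cplx (F : fieldType) m (A : 'M[F]_(m, 5)) a i :
  row i (A *m cplx a) = row3 (A i (inord 0) + A i (inord 1) * a)
    (A i (inord 2) + A i (inord 3) * a) (A i (inord 4)).
Proof.
by apply/rowP; apply: ord3P; rewrite !mxE sum_ord5 !mxE !inordK //=; ring.
Qed.

Lemma rank_cplx (F : fieldType) (a : F) : \rank (cplx a) = 3%N.
Proof.
apply/eqP; rewrite -[_ == _]/(row_full (cplx a)); apply/row_fullP.
(* This left inverse selects rows 0, 2 and 4 of [cplx a], which form the identity. *)
exists (\matrix_(i, j) (j == inord i.*2)%:R); apply/matrixP=> i j.
rewrite !mxE sum_ord5; elim/ord3P: i; elim/ord3P: j;
  by rewrite !mxE -!val_eqE /= !inordK //=; ring.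
Qed.

(** The kernel of [cplx a] has dimension 5 - 3 = 2, so a line contained in it is all of it. *)
Lemma submx_ker_cplx (F : fieldType) (a : F) (G : 'M_(2, 5)) (P : 'rV_5) :
  \rank G = 2%N -> G *m cplx a = 0 -> (P <= G)%MS = (P *m cplx a == 0).
Proof.
move=> rG /sub_kermxP Gker.
have kerG : (kermx (cplx a) <= G)%MS.
  by rewrite -(mxrank_leqif_sup Gker) rG mxrank_ker rank_cplx.
apply/idP/eqP => [PG|/sub_kermxP Pker]; last exact: submx_trans kerG.
by apply/sub_kermxP/(submx_trans PG).
Qed.

(** [cplx a] sends the curve point at (s:t) to [x * s + y * t] times the image of [quad s t] under
    the invertible [H], which is nonzero. The point is therefore on the line exactly when the linear
    form vanishes, that is at the single parameter (y : -x). *)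
Lemma meets_ker_cplx (L : finFieldType) (A : 'M[L]_(4, 5)) (a x y : L)
    (H : 'M_3) (G : 'M_(2, 5)) :
    row_free A -> H \in unitmx -> (x != 0) || (y != 0) ->
    A *m cplx a = linmul x y *m H -> \rank G = 2%N -> G *m cplx a = 0 ->
  meets_in_one_point A G.
Proof.
move=> Afree Hunit xy0 AE rG Ga0.
have onG s t : (moment s t *m A <= G)%MS = (x * s + y * t == 0).
  rewrite (submx_ker_cplx _ rG Ga0) -mulmxA AE mulmxA moment_linmul.
  rewrite -scalemxAl scaler_eq0.
  case: eqVneq => //= xsyt; apply/negP => /eqP/(congr1 (mulmxr (invmx H))).
  rewrite /= mulmxK // mul0mx => /rowP q0; move: xsyt.
  have := q0 (inord 0); have := q0 (inord 2).
  rewrite !mxE !inordK //= => /eqP + /eqP.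
  by rewrite !expf_eq0 /= => /eqP-> /eqP->; rewrite !mulr0 addr0 eqxx.
have solE s t : moment s t != 0 -> x * s + y * t = 0 ->
    exists2 c, c != 0 & moment s t = c *: moment y (- x).
  move=> m0 xsyt; suff [c [sE tE]] : exists c, s = c * y /\ t = c * - x.
    exists (c ^+ 3); last by rewrite -momentZ -sE -tE.
    rewrite expf_neq0 //; apply: contraNneq m0 => c0.
    by rewrite moment_eq0 sE tE c0 !mul0r eqxx.
  have [y0|y0] := eqVneq y 0.
    have x0 : x != 0 by move: xy0; rewrite y0 eqxx orbF.
    exists (- t / x); split; last by field.
    by move/eqP: xsyt; rewrite y0 mul0r addr0 mulf_eq0 (negPf x0) mulr0 => /eqP.
  exists (s / y); split; first by field.
  apply: (mulfI y0); rewrite -[LHS](addKr (x * s)) xsyt; by field.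
split.
  exists (moment y (- x) *m A); split; last by rewrite onG mulrN mulrC subrr.
  split; last by exists y, (- x); rewrite !submx_refl.
  by rewrite row_free_mul_eq0 // moment_eq0 oppr_eq0 negb_and orbC.
have nrcE P : nrcx_pt A P -> (P <= G)%MS -> (P == moment y (- x) *m A)%MS.
  move=> [P0 [s [t /eqmxP mP]]] PG; move: (PG); rewrite -mP onG => /eqP xsyt.
  have m0 : moment s t != 0.
    by apply: contraNneq P0 => m0; rewrite -mxrank_eq0 -mP m0 mul0mx mxrank0.
  have [c c0 mE] := solE _ _ m0 xsyt.
  by apply/eqmxP/(eqmx_trans (eqmx_sym mP)); rewrite mE -scalemxAl; apply: eqmx_scale.
move=> P P' nP PG nP' P'G; apply/eqmxP.
by apply: eqmx_trans (eqmx_sym _); apply/eqmxP; apply: nrcE.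
Qed.

(** * Bruck-Bose coordinates and the transversals of the spread *)

Section BBCoordinates.
Variables (L : finFieldType) (q : nat) (tau : L).
Hypotheses (cardL : #|L| = (q ^ 2)%N) (tauN : tau ^+ q != tau).
Let qL := sqrt_card_pchar cardL.

(** From x + y tau and x + y tau^q one recovers x and y because tau differs from tau^q. Equalities
    in PG(4,q^2) are checked below through these two readings. *)
Lemma eq_cplx m (A B : 'M[L]_(m, 5)) : A *m cplx tau = B *m cplx tau ->
  A *m cplx (tau ^+ q) = B *m cplx (tau ^+ q) -> A = B.
Proof.
move=> e1 e2; apply/matrixP => i.
have := congr1 (row i) e1; have := congr1 (row i) e2; rewrite !mul_cplx.
move=> /rowP e2i /rowP e1i.
have sol (x y x' y' : L) : x + y * tau = x' + y' * tau ->
    x + y * tau ^+ q = x' + y' * tau ^+ q -> x = x' /\ y = y'.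
  move=> f1 f2; have yy' : y = y'.
    have : (y - y') * (tau - tau ^+ q) = 0.
      by rewrite -[RHS](subrr (x' + y' * tau)) -{1}f1 -[x'](addrK (y' * tau ^+ q)) -f2; ring.
    by move/eqP; rewrite mulf_eq0 (negPf (tau_sub_neq0 tauN)) orbF subr_eq0 => /eqP.
  by split=> //; move: f1; rewrite yy' => /addIr.
have := e1i (inord 0); have := e2i (inord 0); have := e1i (inord 1).
have := e2i (inord 1); have := e1i (inord 2); rewrite !mxE !inordK //=.
move=> e4 f1 f2 f3 f4; have [e2' e3] := sol _ _ _ _ f2 f1.
have [e0 e1'] := sol _ _ _ _ f4 f3.
exact: ord5P.
Qed.

(** A version of [bb_aff] that keeps the last coordinate instead of normalizing it to 1; the result
    is F_q-rational once the last column is. *)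
Definition bbmx m (W : 'M[L]_(m, 3)) : 'M[L]_(m, 5) :=
  \matrix_i vec5 (c0 q tau (W i (inord 0))) (c1 q tau (W i (inord 0)))
                 (c0 q tau (W i (inord 1))) (c1 q tau (W i (inord 1)))
                 (W i (inord 2)).

Lemma bbmx_cplx m (W : 'M[L]_(m, 3)) : bbmx W *m cplx tau = W.
Proof.
apply/row_matrixP => i; rewrite mul_cplx; apply/rowP; apply: ord3P;
  by rewrite !mxE !inordK //= 1?mulrC ?c0c1E.
Qed.

Lemma bbmx_cplx_conj m (W : 'M[L]_(m, 3)) : (forall i, W i (inord 2) \in Fq qL) ->
  bbmx W *m cplx (tau ^+ q) = conjq q W.
Proof.
move=> WF; apply/row_matrixP => i; rewrite mul_cplx; apply/rowP; apply: ord3P;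
  rewrite !mxE !inordK //= 1?mulrC ?c0c1_conjE //.
by move/eqP: (WF i).
Qed.

Lemma bbmx_Fq m (W : 'M[L]_(m, 3)) : (forall i, W i (inord 2) \in Fq qL) ->
  Fq_mx q (bbmx W).
Proof.
move=> WF; apply/forallP => i; apply/forallP; apply: ord5P; rewrite !mxE inordK //=;
  by [exact: (c0_Fq tau cardL)|exact: (c1_Fq tau cardL)|exact: WF].
Qed.

Lemma bbdir_cplx x y : bbdir q tau x y *m cplx tau = row3 x y 0.
Proof.
apply/rowP => j; have /rowP/(_ j) := mul_cplx (bbdir q tau x y) tau ord0.
by rewrite [LHS]mxE => ->; rewrite !mxE !inordK //= ![_ * tau]mulrC !c0c1E.
Qed.

Lemma bbdir_cplx_conj x y :
  bbdir q tau x y *m cplx (tau ^+ q) = row3 (x ^+ q) (y ^+ q) 0.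
Proof.
apply/rowP => j; have /rowP/(_ j) := mul_cplx (bbdir q tau x y) (tau ^+ q) ord0.
by rewrite [LHS]mxE => ->; rewrite !mxE !inordK //= ![_ * tau ^+ q]mulrC !c0c1_conjE.
Qed.

Lemma bb_aff_cplx P : affine P ->
  bb_aff q tau P *m cplx tau = (P ord0 (inord 2))^-1 *: P.
Proof.
move=> P2; apply/rowP => j; have /rowP/(_ j) := mul_cplx (bb_aff q tau P) tau ord0.
rewrite [LHS]mxE => ->; elim/ord3P: j;
  by rewrite !mxE !inordK //= 1?[_ * tau]mulrC ?c0c1E ?mulVf // mulrC.
Qed.

Lemma bb_aff_cplx_conj P : affine P ->
  bb_aff q tau P *m cplx (tau ^+ q) = conjq q ((P ord0 (inord 2))^-1 *: P).
Proof.
move=> P2; apply/rowP => j.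
have /rowP/(_ j) := mul_cplx (bb_aff q tau P) (tau ^+ q) ord0.
rewrite [LHS]mxE => ->; elim/ord3P: j;
  rewrite !mxE !inordK //= 1?[_ * tau ^+ q]mulrC ?c0c1_conjE ?mulVf ?expr1n //;
  by rewrite mulrC.
Qed.

(** For the combination with coefficients x, y in [L] of the two spanning rows, the factors are x +
    y tau and x + y tau^q; they are conjugate when x, y lie in F_q, but not in general. *)
Lemma spread_mx_cplx T p : (p <= spread_mx q tau T)%MS ->
  exists a b, p *m cplx tau = a *: row3 (T ord0 (inord 0)) (T ord0 (inord 1)) 0
    /\ p *m cplx (tau ^+ q) =
         b *: row3 (T ord0 (inord 0) ^+ q) (T ord0 (inord 1) ^+ q) 0.
Proof.
rewrite -addsmxE => /sub_addsmxP[[u v] /= ->].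
rewrite (mx11_scalar u) (mx11_scalar v) !mul_scalar_mx.
move: (u 0 0) (v 0 0) => x y; exists (x + y * tau), (x + y * tau ^+ q).
rewrite !mulmxDl -!scalemxAl !bbdir_cplx !bbdir_cplx_conj.
by split; apply/rowP; apply: ord3P; rewrite !mxE !inordK //= ?exprMn; ring.
Qed.

Lemma rV2_span (p0 p1 : 'rV[L]_5) (G : 'M[L]_(2, 5)) : \rank G = 2%N ->
    (p0 <= G)%MS -> (p1 <= G)%MS ->
    (forall x y, x *: p0 + y *: p1 = 0 -> x = 0 /\ y = 0) ->
  (G <= p0 + p1)%MS.
Proof.
move=> rG p0G p1G indep; rewrite addsmxE.
have sG : (col_mx p0 p1 <= G)%MS by rewrite -addsmxE addsmx_sub p0G.
rewrite -(mxrank_leqif_sup sG) rG.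
rewrite -[_ == _]/(row_free (col_mx p0 p1)) -kermx_eq0.
apply/rowV0P => u /sub_kermxP; rewrite -[u]hsubmxK mul_row_col.
rewrite (mx11_scalar (lsubmx u)) (mx11_scalar (rsubmx u)) !mul_scalar_mx.
by move=> /indep[-> ->]; rewrite !raddf0 row_mx0.
Qed.

(* A transversal meets the spread lines of (1:0) and (0:1) in points with
   complex coordinates (a, b) and (c, d); meeting those of (1:1) and (1:tau)
   forces cb = da = 0. *)
Lemma spread_transversal_ker (G : 'M[L]_(2, 5)) : spread_transversal q tau G ->
  \rank G = 2%N /\ (G *m cplx tau = 0 \/ G *m cplx (tau ^+ q) = 0).
Proof.
case=> rG meetG; split=> //.
have pt x y : (x != 0) || (y != 0) -> exists p : 'rV_5, exists a b,
    [/\ (p <= G)%MS, (a != 0) || (b != 0), p *m cplx tau = a *: row3 x y 0 &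
     p *m cplx (tau ^+ q) = b *: row3 (x ^+ q) (y ^+ q) 0].
  move=> xy0; have Tinf : on_linf (row3 x y 0).
    rewrite /on_linf mxE inordK //= eqxx andbT; apply/eqP => /rowP T0.
    by have := T0 (inord 0); have := T0 (inord 1); rewrite !mxE !inordK //=;
       move=> y0 x0; move: xy0; rewrite x0 y0 eqxx.
  have /rowV0Pn[p pGT p0] := meetG _ Tinf.
  have [pG pT] : (p <= G)%MS /\ (p <= spread_mx q tau (row3 x y 0))%MS.
    by split; apply: submx_trans pGT _; rewrite ?capmxSl ?capmxSr.
  have [a [b []]] := spread_mx_cplx pT; rewrite !mxE !inordK //= => pa pb.
  exists p, a, b; split=> //; apply: contraNT p0; rewrite negb_or !negbK.
  move=> /andP[/eqP a0 /eqP b0]; apply/eqP/eq_cplx; rewrite mul0mx.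
    by rewrite pa a0 scale0r.
  by rewrite pb b0 scale0r.
have q_gt0 : (0 < q)%N by case/andP: qL.
have [|p0 [a [b [p0G ab0 p0a p0b]]]] := pt 1 0; first by rewrite oner_eq0.
have [|p1 [c [d [p1G cd0 p1c p1d]]]] := pt 0 1; first by rewrite oner_eq0 orbT.
rewrite expr1n expr0n (gtn_eqF q_gt0) /= in p0b p1d.
have cancel (x a' b' : L) : (a' != 0) || (b' != 0) -> x * a' = 0 -> x * b' = 0 -> x = 0.
  by case/orP=> n0 /eqP + /eqP; rewrite !mulf_eq0 (negPf n0) orbF => /eqP // _ /eqP.
have coord x y : (x *: p0 + y *: p1) *m cplx tau = row3 (x * a) (y * c) 0 /\
    (x *: p0 + y *: p1) *m cplx (tau ^+ q) = row3 (x * b) (y * d) 0.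
  rewrite !mulmxDl -!scalemxAl p0a p0b p1c p1d.
  by split; apply/rowP; apply: ord3P; rewrite !mxE !inordK //=; ring.
have indep x y : x *: p0 + y *: p1 = 0 -> x = 0 /\ y = 0.
  move=> xy0; have := coord x y; rewrite xy0 !mul0mx => -[/rowP e /rowP f].
  have := e (inord 0); have := e (inord 1); have := f (inord 0).
  have := f (inord 1); rewrite !mxE !inordK //= => yd xb yc xa.
  by split; [apply: (cancel x a b)|apply: (cancel y c d)].
have Gsub := rV2_span rG p0G p1G indep.
(* The point x p0 + y p1 over (1:th) has readings (xa, yc) = e (1, th) and (xb, yd) = f (1, th^q);
   eliminating e and f gives the relation. *)
have key th : th != 0 -> c * b * th ^+ q = d * a * th.
  move=> th0; have [|p [e [f [pG ef0 pe pf]]]] := pt 1 th; first by rewrite oner_eq0.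
  have /sub_addsmxP[[u v] /= pE] := submx_trans pG Gsub.
  move: pE; rewrite (mx11_scalar u) (mx11_scalar v) !mul_scalar_mx.
  move: (u 0 0) (v 0 0) => x y pE.
  have := coord x y; rewrite -pE pe pf => -[/rowP g /rowP h].
  have := g (inord 0); have := g (inord 1); have := h (inord 0).
  have := h (inord 1); rewrite !mxE !inordK //= ?expr1n !mulr1 => fy fx ey ex.
  have x0 : x != 0.
    by apply: contraTneq ef0 => x0; rewrite ex fx x0 !mul0r eqxx.
  have y0 : y != 0.
    apply: contraTneq ef0 => y0; move/eqP: ey; move/eqP: fy.
    by rewrite y0 !mul0r !mulf_eq0 expf_eq0 (negPf th0) andbF !orbF => -> ->.
  apply: (mulfI (mulf_neq0 x0 y0)).
  have -> : x * y * (c * b * th ^+ q) = (y * c) * (x * b) * th ^+ q by ring.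
  have -> : x * y * (d * a * th) = (y * d) * (x * a) * th by ring.
  by rewrite -ey -fx -fy -ex; ring.
have cbda : c * b = d * a by have := key 1 (oner_neq0 _); rewrite expr1n !mulr1.
have tau0 : tau != 0.
  by apply: contraNneq tauN => ->; rewrite expr0n (gtn_eqF q_gt0).
have /eqP : c * b * (tau ^+ q - tau) = 0 by rewrite mulrBr key // cbda subrr.
rewrite mulf_eq0 subr_eq0 (negPf tauN) orbF => cb0.
have /eqP := cb0; rewrite cbda => /eqP; move: cb0; rewrite !mulf_eq0.
have Gker e : p0 *m cplx e = 0 -> p1 *m cplx e = 0 -> G *m cplx e = 0.
  move=> k0 k1; have /sub_addsmxP[[u v] /= ->] := Gsub.
  by rewrite mulmxDl -!mulmxA k0 k1 !mulmx0 addr0.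
(* If a = 0 then b is nonzero, so c = 0 and the first reading kills both spanning points; otherwise
   d = 0, so c is nonzero and b = 0, and the second reading does. *)
move=> cb0 da0; have [a0|a0] := eqVneq a 0.
  left; move: ab0 cb0 da0; rewrite a0 eqxx /= => /negPf->; rewrite orbF => /eqP c0 _.
  by apply: Gker; rewrite ?p0a ?p1c ?a0 ?c0 scale0r.
right; move: cd0 cb0 da0; rewrite (negPf a0) orbF => + + /eqP d0.
rewrite d0 eqxx orbF => /negPf-> /= /eqP b0.
by apply: Gker; rewrite ?p0b ?p1d ?b0 ?d0 scale0r.
Qed.

End BBCoordinates.

(** * Ternary quadratic forms and parametrization of a conic *)

Section Conic.
Variable L : finFieldType.
Implicit Types (k : 'rV[L]_6) (u v w : 'rV[L]_3) (N : 'M[L]_3).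

Definition polar k u v : L := Qform k (u + v) - Qform k u - Qform k v.

Lemma QformD k a b u v :
  Qform k (a *: u + b *: v) =
  a ^+ 2 * Qform k u + b ^+ 2 * Qform k v + a * b * polar k u v.
Proof. by rewrite /polar /Qform !mxE; ring. Qed.

Lemma polar_comb k a b u v w :
  polar k u (a *: v + b *: w) = a * polar k u v + b * polar k u w.
Proof. by rewrite /polar /Qform !mxE; ring. Qed.

Lemma det_mx2 (A : 'M[L]_2) : \det A = A 0 0 * A 1 1 - A 0 1 * A 1 0.
Proof.
rewrite (expand_det_row _ 0) !big_ord_recl big_ord0 /cofactor !det_mx11 !mxE /=.
have e0 : lift 0 0 = 1 :> 'I_2 by apply: val_inj.
have e1 : lift 1 0 = 0 :> 'I_2 by apply: val_inj.
by rewrite !e0 ?e1; ring.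
Qed.

Lemma det_mx3 N : \det N =
  N (inord 0) (inord 0) * (N (inord 1) (inord 1) * N (inord 2) (inord 2)
                           - N (inord 1) (inord 2) * N (inord 2) (inord 1))
  - N (inord 0) (inord 1) * (N (inord 1) (inord 0) * N (inord 2) (inord 2)
                             - N (inord 1) (inord 2) * N (inord 2) (inord 0))
  + N (inord 0) (inord 2) * (N (inord 1) (inord 0) * N (inord 2) (inord 1)
                             - N (inord 1) (inord 1) * N (inord 2) (inord 0)).
Proof.
have liftE (i : 'I_3) (j : 'I_2) n : bump i j = n -> lift i j = inord n.
  by move=> <-; rewrite -[bump i j]/(nat_of_ord (lift i j)) inord_val.
rewrite (expand_det_row _ (inord 0)) sum_ord3 /cofactor !det_mx2 !mxE !inordK //=.
have l00 : lift (inord 0) 0 = inord 1 :> 'I_3 by apply: liftE; rewrite /= inordK.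
have l01 : lift (inord 0) 1 = inord 2 :> 'I_3 by apply: liftE; rewrite /= inordK.
have l10 : lift (inord 1) 0 = inord 0 :> 'I_3 by apply: liftE; rewrite /= inordK.
have l11 : lift (inord 1) 1 = inord 2 :> 'I_3 by apply: liftE; rewrite /= inordK.
have l20 : lift (inord 2) 0 = inord 0 :> 'I_3 by apply: liftE; rewrite /= inordK.
have l21 : lift (inord 2) 1 = inord 1 :> 'I_3 by apply: liftE; rewrite /= inordK.
by rewrite l00 l01 l10 l11 l20 l21; ring.
Qed.

(** The right-hand side is [qdisc] of the form rewritten in the basis of rows of [N]: its square
    coefficients are the values of Q, its mixed coefficients the polar values. *)
Lemma qdisc_base_change k N (u := fun i => row (inord i) N) :
  \det N ^+ 2 * qdisc k =
  4%:R * Qform k (u 0%N) * Qform k (u 1%N) * Qform k (u 2%N)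
  + polar k (u 1%N) (u 2%N) * polar k (u 0%N) (u 2%N) * polar k (u 0%N) (u 1%N)
  - Qform k (u 0%N) * polar k (u 1%N) (u 2%N) ^+ 2
  - Qform k (u 1%N) * polar k (u 0%N) (u 2%N) ^+ 2
  - Qform k (u 2%N) * polar k (u 0%N) (u 1%N) ^+ 2.
Proof. by rewrite det_mx3 /u /polar /Qform /qdisc !mxE; ring. Qed.

(* The residual intersections of the conic with the lines through its point
   u0 = row 0 of N: the row [quad s t *m conic_mx k N *m N] is
   Q(w) u0 - polar(u0, w) w with w = s u1 + t u2. *)
Definition conic_mx k N : 'M[L]_3 :=
  let u i := row (inord i) N in
  let b01 := polar k (u 0%N) (u 1%N) in let b02 := polar k (u 0%N) (u 2%N) in
  \matrix_i nth 0 [:: row3 (Qform k (u 1%N)) (- b01) 0;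
                      row3 (polar k (u 1%N) (u 2%N)) (- b02) (- b01);
                      row3 (Qform k (u 2%N)) 0 (- b02)] i.

(** When Q(u0) = 0 the determinant is minus the discriminant in the basis [N], so a non-degenerate
    conic is a projective image of the standard one [quad]. *)
Lemma conic_mx_unit k N : N \in unitmx -> qdisc k != 0 ->
  Qform k (row (inord 0) N) = 0 -> conic_mx k N \in unitmx.
Proof.
move=> Nu disc0 Q0; rewrite unitmxE unitfE.
suff -> : \det (conic_mx k N) = - (\det N ^+ 2 * qdisc k).
  by rewrite oppr_eq0 mulf_neq0 ?expf_neq0 // -unitfE -unitmxE.
rewrite qdisc_base_change Q0 det_mx3 /conic_mx.
by rewrite !mxE !inordK //= !mxE !inordK //=; ring.
Qed.

Lemma quad_conic_mx k N s t (u := fun i => row (inord i) N)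
    (w := s *: u 1%N + t *: u 2%N) :
  quad s t *m conic_mx k N *m N =
  Qform k w *: u 0%N - polar k (u 0%N) w *: w.
Proof.
rewrite QformD polar_comb; apply/rowP=> j; rewrite !mxE sum_ord3 !mxE !sum_ord3.
by rewrite !mxE !inordK //= !mxE !inordK //=; ring.
Qed.

Lemma quad_eq0 s t : (quad s t == 0 :> 'rV[L]_3) = (s == 0) && (t == 0).
Proof.
apply/eqP/andP => [/rowP q0|[/eqP-> /eqP->]].
  have := q0 (inord 0); have := q0 (inord 2); rewrite !mxE !inordK //=.
  by move=> /eqP + /eqP; rewrite !expf_eq0 /= => -> ->.
by apply/rowP; apply: ord3P; rewrite !mxE !inordK //=; ring.
Qed.

End Conic.

(** * F_q-rational matrices, forms and bases *)

Section ConicFq.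
Variables (L : finFieldType) (q : nat).
Hypothesis (cardL : #|L| = (q ^ 2)%N).
Let qL := sqrt_card_pchar cardL.

Lemma Fq_mxP m n (A : 'M[L]_(m, n)) :
  reflect (forall i j, A i j \in Fq qL) (Fq_mx q A).
Proof.
apply: (iffP forallP) => [AF i j|AF i]; first by move/forallP: (AF i); apply.
by apply/forallP => j; apply: AF.
Qed.

Lemma conjqE m n (A : 'M[L]_(m, n)) : conjq q A = map_mx (frobq qL) A.
Proof. by []. Qed.

Lemma Fq_mxE m n (A : 'M[L]_(m, n)) : Fq_mx q A <-> conjq q A = A.
Proof.
split=> [/Fq_mxP AF|AE].
  by apply/matrixP => i j; rewrite mxE; apply/eqP/AF.
by apply/Fq_mxP => i j; rewrite FqE -{2}AE mxE.
Qed.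

Lemma conjqM m n p (A : 'M[L]_(m, n)) (B : 'M_(n, p)) :
  conjq q (A *m B) = conjq q A *m conjq q B.
Proof. by rewrite !conjqE map_mxM. Qed.

Lemma Qform_Fq k (v : 'rV[L]_3) : Fq_mx q k -> Fq_mx q v -> Qform k v \in Fq qL.
Proof.
move=> /Fq_mxP kF /Fq_mxP vF.
by rewrite /Qform /kc !(rpredD, rpredM, rpredX, kF, vF).
Qed.

Lemma polar_Fq k (u v : 'rV[L]_3) :
  Fq_mx q k -> Fq_mx q u -> Fq_mx q v -> polar k u v \in Fq qL.
Proof.
move=> kF uF vF; rewrite /polar !rpredB ?Qform_Fq //; apply/Fq_mxP => i j.
by move/Fq_mxP: uF => uF; move/Fq_mxP: vF => vF; rewrite mxE rpredD.
Qed.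

(** Two standard basis vectors are added to [v], leaving out the one at a nonzero coordinate of [v];
    up to sign that coordinate is the determinant. *)
Lemma complete_Fq_basis (v : 'rV[L]_3) : v != 0 -> Fq_mx q v ->
  exists N : 'M[L]_3, [/\ N \in unitmx, Fq_mx q N & row (inord 0) N = v].
Proof.
move=> v0 /Fq_mxP vF.
pose N a b : 'M[L]_3 :=
  \matrix_i nth 0 [:: v; delta_mx 0 (inord a); delta_mx 0 (inord b)] i.
have NF a b : Fq_mx q (N a b).
  apply/Fq_mxP; apply: ord3P => j; rewrite mxE inordK //= ?mxE //.
    by case: andb; rewrite ?rpred0 ?rpred1.
  by case: andb; rewrite ?rpred0 ?rpred1.
have N0 a b : row (inord 0) (N a b) = v by apply/rowP => j; rewrite !mxE inordK.
have detN a b : (N a b \in unitmx) = (\det (N a b) != 0) by rewrite unitmxE unitfE.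
have [v00|v00] := eqVneq (v 0 (inord 0)) 0; last first.
  exists (N 1%N 2%N); split=> //; rewrite detN det_mx3 !mxE !inordK //=.
  rewrite !mxE -!val_eqE /= !inordK //=.
  by rewrite !(mul0r, mulr0, subr0, mulr1, mul1r, addr0).
have [v01|v01] := eqVneq (v 0 (inord 1)) 0; last first.
  exists (N 0%N 2%N); split=> //; rewrite detN det_mx3 !mxE !inordK //=.
  rewrite !mxE -!val_eqE /= !inordK //=.
  by rewrite v00 !(mul0r, mulr0, subr0, mulr1, mul1r, addr0, sub0r, oppr_eq0).
exists (N 0%N 1%N); split=> //; rewrite detN det_mx3 !mxE !inordK //=.
rewrite !mxE -!val_eqE /= !inordK //=.
rewrite v00 v01 !(mul0r, mulr0, subr0, mulr1, mul1r, addr0, oppr0, add0r).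
apply: contraNneq v0 => v02; apply/eqP/rowP; by apply: ord3P; rewrite !mxE ?v00 ?v01 ?v02.
Qed.

End ConicFq.

(** * The twisted cubic of a conic through the point at infinity *)

Section ConicCubic.
Variables (L : finFieldType) (q : nat) (tau : L) (M N : 'M[L]_3) (k : 'rV[L]_6).
Hypotheses (cardL : #|L| = (q ^ 2)%N) (tauN : tau ^+ q != tau).
Hypotheses (Munit : M \in unitmx) (kF : Fq_mx q k) (kdisc : qdisc k != 0).
Hypotheses (Nunit : N \in unitmx) (NF : Fq_mx q N).
Let u i := row (inord i) N.
Let pt s t := s *: u 1%N + t *: u 2%N.
Let alpha := (u 1%N *m M) ord0 (inord 2).
Let beta := (u 2%N *m M) ord0 (inord 2).
Hypotheses (Qu0 : Qform k (u 0%N) = 0) (u0_inf : (u 0%N *m M) ord0 (inord 2) = 0).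
Let qL := sqrt_card_pchar cardL.
(** The last coordinate of the image of [pt s t]. That it has no nontrivial zero over F_q is how
    tangency of the Baer subplane is expressed. *)
Let line s t := alpha * s + beta * t.
Hypothesis lineN0 : forall s t, s \in Fq qL -> t \in Fq qL ->
  (s != 0) || (t != 0) -> line s t != 0.
Let b01 := polar k (u 0%N) (u 1%N).
Let b02 := polar k (u 0%N) (u 2%N).
(** The polar value of u0 and [pt s t]; its zero is the direction of the tangent at u0, where the
    residual point [cpt s t] is u0 itself. *)
Let tangent s t := s * b01 + t * b02.
Let cpt s t := quad s t *m conic_mx k N *m N.
Let H := conic_mx k N *m N *m M.

Let uF i : Fq_mx q (u i).
Proof. by apply/(Fq_mxP cardL) => a b; rewrite mxE; apply/(Fq_mxP cardL). Qed.

Let b01F : b01 \in Fq qL. Proof. exact: polar_Fq. Qed.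
Let b02F : b02 \in Fq qL. Proof. exact: polar_Fq. Qed.

Let Runit : conic_mx k N \in unitmx. Proof. exact: conic_mx_unit. Qed.

Let Hunit : H \in unitmx.
Proof. by rewrite !unitmx_mul Runit Nunit Munit. Qed.

Let cptE s t : cpt s t = Qform k (pt s t) *: u 0%N - tangent s t *: pt s t.
Proof. by rewrite /cpt quad_conic_mx polar_comb. Qed.

Let cpt_eq0 s t : (cpt s t == 0) = (s == 0) && (t == 0).
Proof.
rewrite -quad_eq0; apply/eqP/eqP => [|q0]; last by rewrite /cpt q0 !mul0mx.
move=> /(congr1 (mulmxr (invmx N))); rewrite /cpt /= mulmxK // mul0mx.
by move=> /(congr1 (mulmxr (invmx (conic_mx k N)))); rewrite /= mulmxK // mul0mx.
Qed.

Let cpt_inf s t : (cpt s t *m M) ord0 (inord 2) = - (tangent s t * line s t).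
Proof.
have coord (a b : L) (x y : 'rV_3) :
    (a *: x + b *: y) ord0 (inord 2) = a * x ord0 (inord 2) + b * y ord0 (inord 2).
  by rewrite !mxE.
rewrite cptE -scaleNr mulmxDl -!scalemxAl coord u0_inf /pt mulmxDl -!scalemxAl coord.
by rewrite -/alpha -/beta /line; ring.
Qed.

Let ptF s t : s \in Fq qL -> t \in Fq qL -> Fq_mx q (pt s t).
Proof.
move=> sF tF; apply/(Fq_mxP cardL) => i j; rewrite !mxE.
by rewrite rpredD ?rpredM //; apply/(Fq_mxP cardL).
Qed.

Let tangentF s t : s \in Fq qL -> t \in Fq qL -> tangent s t \in Fq qL.
Proof. by move=> sF tF; rewrite rpredD ?rpredM. Qed.

Let cptF s t : s \in Fq qL -> t \in Fq qL -> Fq_mx q (cpt s t).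
Proof.
move=> sF tF; apply/(Fq_mxP cardL) => i j; rewrite cptE -scaleNr.
have pF := ptF sF tF; have /(Fq_mxP cardL) pF' := pF; have /(Fq_mxP cardL) uF' := uF 0%N.
by rewrite mxE [X in X + _]mxE [X in _ + X]mxE rpredD ?rpredM ?rpredN ?Qform_Fq ?tangentF.
Qed.

Let Qform_cpt s t : Qform k (cpt s t) = 0.
Proof. by rewrite cptE -scaleNr QformD Qu0 polar_comb /tangent -/b01 -/b02; ring. Qed.

Let conic_cpt s t : s \in Fq qL -> t \in Fq qL -> (s != 0) || (t != 0) ->
  conic_pt q M k (cpt s t *m M).
Proof.
move=> sF tF st0; split; last by exists (cpt s t); rewrite cptF // Qform_cpt !submx_refl.
rewrite row_free_mul_eq0 ?row_free_unit // cpt_eq0.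
by rewrite negb_and.
Qed.

(** Write v = x u0 + [pt s t] in the basis [N]. Then Q(v) = 0 says that Q([pt s t]) = - x
    [tangent s t], which turns [cptE] into the claimed multiple of v. If [tangent s t] were zero, s
    and t would vanish and v would be at infinity. *)
Let conic_param v : Fq_mx q v -> Qform k v = 0 -> (v *m M) ord0 (inord 2) != 0 ->
  exists s t, [/\ s \in Fq qL, t \in Fq qL, tangent s t != 0 &
    cpt s t = - tangent s t *: v].
Proof.
move=> vF Qv vaff; pose c := v *m invmx N.
have cF : Fq_mx q c.
  have invF : Fq_mx q (invmx N).
    apply/(Fq_mxE cardL); rewrite (conjqE cardL) map_invmx -(conjqE cardL).
    by congr invmx; apply/(Fq_mxE cardL).
  by apply/(Fq_mxE cardL); rewrite (conjqM cardL); congr (_ *m _); apply/(Fq_mxE cardL).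
have /(Fq_mxP cardL) cF' := cF.
set s := c ord0 (inord 1); set t := c ord0 (inord 2); set x := c ord0 (inord 0).
have vE : v = x *: u 0%N + 1 *: pt s t.
  rewrite -[v](mulmxKV Nunit) mulmx_sum_row sum_ord3 scale1r /pt addrA.
  by [].
have [sF tF] : s \in Fq qL /\ t \in Fq qL by split; apply: cF'.
have Qpt : Qform k (pt s t) = - (x * tangent s t).
  by move: Qv; rewrite vE QformD Qu0 polar_comb -/b01 -/b02 -/(tangent s t);
    rewrite mulr0 add0r expr1n !mul1r mulr1 => /eqP; rewrite addr_eq0 => /eqP.
have cptvE : cpt s t = - tangent s t *: v.
  by rewrite cptE -scaleNr Qpt vE scale1r [RHS]scalerDr scalerA [x * _]mulrC -mulNr.
exists s, t; split=> //; apply: contraNneq vaff => tan0.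
have /eqP : cpt s t = 0 by rewrite cptvE tan0 oppr0 scale0r.
rewrite cpt_eq0 => /andP[/eqP s0 /eqP t0].
rewrite vE /pt s0 t0 !scale0r addr0 scaler0 addr0 -scalemxAl mxE u0_inf.
by rewrite mulr0.
Qed.

(** Coefficients of the cubic forms (alpha^q s + beta^q t) [cpt s t *m M]; for s, t in F_q the
    linear factor is the conjugate of [line s t]. *)
Let W := linmul (frobq qL alpha) (frobq qL beta) *m H.
Let A := bbmx q tau W.

(** The last cubic form is minus [tangent] times the norm of [line], whose coefficients are two
    norms and a trace down to F_q. *)
Let W_inf i : W i (inord 2) \in Fq qL.
Proof.
have norm x : x * frobq qL x \in Fq qL.
  by rewrite FqE rmorphM /= (frobqK qL cardL) mulrC.
have trace : alpha * frobq qL beta + beta * frobq qL alpha \in Fq qL.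
  by rewrite FqE rmorphD !rmorphM /= !(frobqK qL cardL) addrC mulrC [_ * beta]mulrC.
have Hcol j : H j (inord 2) = conic_mx k N j (inord 1) * alpha
                             + conic_mx k N j (inord 2) * beta.
  rewrite /H -mulmxA mxE sum_ord3.
  have NME l : (N *m M) (inord l) (inord 2) = (u l *m M) ord0 (inord 2).
    by rewrite /u -row_mul [RHS]mxE.
  by rewrite !NME u0_inf mulr0 add0r.
have aa := norm alpha; have bb := norm beta.
rewrite /W mxE sum_ord3 !Hcol; elim/ord4P: i; rewrite !mxE !inordK //= !mxE !inordK //=.
- rewrite [X in X \in _](_ : _ = - (b01 * (alpha * frobq qL alpha))).
    by rewrite rpredN rpredM.
  by rewrite -/b01; ring.
- rewrite [X in X \in _](_ : _ = - (b01 * (alpha * frobq qL beta + beta * frobq qL alpha))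
                                 - b02 * (alpha * frobq qL alpha)).
    by apply: rpredB; rewrite ?rpredN; apply: rpredM.
  by rewrite -/b01 -/b02; ring.
- rewrite [X in X \in _](_ : _ = - (b01 * (beta * frobq qL beta))
             - b02 * (alpha * frobq qL beta + beta * frobq qL alpha)).
    by apply: rpredB; rewrite ?rpredN; apply: rpredM.
  by rewrite -/b01 -/b02; ring.
- rewrite [X in X \in _](_ : _ = - (b02 * (beta * frobq qL beta))).
    by rewrite rpredN rpredM.
  by rewrite -/b02; ring.
Qed.

Let A_cplx : A *m cplx tau = linmul (frobq qL alpha) (frobq qL beta) *m H.
Proof. exact: bbmx_cplx. Qed.

Let conjq_linmul x y : conjq q (linmul x y) = linmul (frobq qL x) (frobq qL y) :> 'M[L]_(4, 3).
Proof.
rewrite (conjqE cardL); apply/matrixP => i j; rewrite mxE.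
by elim/ord4P: i; elim/ord3P: j; rewrite !mxE !inordK //= rmorph0.
Qed.

Let A_cplx_conj : A *m cplx (tau ^+ q) = linmul alpha beta *m conjq q H.
Proof.
rewrite (bbmx_cplx_conj tauN W_inf) (conjqM cardL) conjq_linmul.
by rewrite !(frobqK qL cardL).
Qed.

Let A_Fq : Fq_mx q A. Proof. exact: bbmx_Fq W_inf. Qed.

(** Equality would put alpha / beta in F_q and give [line] the F_q-zero (1 : - alpha / beta). *)
Let alphabeta : alpha * frobq qL beta != frobq qL alpha * beta.
Proof.
have beta0 : beta != 0.
  have := @lineN0 0 1 (rpred0 _) (rpred1 _); rewrite oner_eq0 orbT => /(_ isT).
  by rewrite /line mulr0 add0r mulr1.
apply/eqP => ab; have rF : alpha / beta \in Fq qL.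
  rewrite FqE fmorph_div /= eqr_div ?fmorph_eq0 //.
  by rewrite eq_sym ab.
have := @lineN0 1 (- (alpha / beta)) (rpred1 _).
rewrite rpredN => /(_ rF); rewrite oner_eq0 => /(_ isT) /eqP; apply.
by rewrite /line; field.
Qed.

(** After cancelling [H] and its conjugate, a dependency is killed by both [linmul] matrices. Their
    columns 0 and 2 give 2 by 2 systems for its first and last two entries, with determinant nonzero
    by [alphabeta]. *)
Let A_free : row_free A.
Proof.
rewrite -kermx_eq0; apply/rowV0P => v /sub_kermxP vA.
have v1 : v *m linmul (frobq qL alpha) (frobq qL beta) = 0.
  apply/eqP; rewrite -(row_free_mul_eq0 _ (_ : row_free H)) ?row_free_unit //.
  by rewrite -mulmxA -A_cplx mulmxA vA mul0mx.
have v2 : v *m linmul alpha beta = 0.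
  apply/eqP; rewrite -(row_free_mul_eq0 _ (_ : row_free (conjq q H))) ?row_free_unit.
    by rewrite -mulmxA -A_cplx_conj mulmxA vA mul0mx.
  by rewrite (conjqE cardL) map_unitmx.
have D0 : alpha * frobq qL beta - frobq qL alpha * beta != 0 by rewrite subr_eq0.
have sol x y : frobq qL alpha * x + frobq qL beta * y = 0 ->
    alpha * x + beta * y = 0 -> x = 0 /\ y = 0.
  move=> e1 e2; split; apply: (mulfI D0); rewrite mulr0.
    rewrite [LHS](_ : _ = frobq qL beta * (alpha * x + beta * y)
                          - beta * (frobq qL alpha * x + frobq qL beta * y)); last by ring.
    by rewrite e1 e2 !mulr0 subr0.
  rewrite [LHS](_ : _ = alpha * (frobq qL alpha * x + frobq qL beta * y)
                        - frobq qL alpha * (alpha * x + beta * y)); last by ring.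
  by rewrite e1 e2 !mulr0 subr0.
have /rowP v1' := v1; have /rowP v2' := v2.
have [v00 v01] : v 0 (inord 0) = 0 /\ v 0 (inord 1) = 0.
  have := v1' (inord 0); have := v2' (inord 0).
  rewrite !mxE !sum_ord4 !mxE !inordK //= !mulr0 !addr0 ![v _ _ * _]mulrC.
  by move=> e2 e1; apply: sol.
have [v02 v03] : v 0 (inord 2) = 0 /\ v 0 (inord 3) = 0.
  have := v1' (inord 2); have := v2' (inord 2).
  rewrite !mxE !sum_ord4 !mxE !inordK //= !mulr0 !add0r ![v _ _ * _]mulrC.
  by move=> e2 e1; apply: sol.
by apply/rowP; apply: ord4P; rewrite mxE.
Qed.

Let conjq_moment s t : s \in Fq qL -> t \in Fq qL -> conjq q (moment s t) = moment s t.
Proof.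
move=> sF tF; apply/(Fq_mxE cardL)/(Fq_mxP cardL) => i; apply: ord4P;
  by rewrite mxE inordK //= ?rpredM ?rpredX.
Qed.

Let moment_W s t : s \in Fq qL -> t \in Fq qL ->
  moment s t *m W = frobq qL (line s t) *: (cpt s t *m M).
Proof.
move=> sF tF; rewrite /W mulmxA moment_linmul -scalemxAl /cpt /H !mulmxA.
by rewrite /line rmorphD !rmorphM /= (frobq_Fq sF) (frobq_Fq tF).
Qed.

Let moment_A s t : s \in Fq qL -> t \in Fq qL ->
  moment s t *m A *m cplx tau = frobq qL (line s t) *: (cpt s t *m M) /\
  moment s t *m A *m cplx (tau ^+ q) =
    conjq q (frobq qL (line s t) *: (cpt s t *m M)).
Proof.
move=> sF tF; rewrite -moment_W // (conjqM cardL) conjq_moment // -!mulmxA A_cplx.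
by rewrite (bbmx_cplx_conj tauN W_inf).
Qed.

Let conjqZ m n c (B : 'M[L]_(m, n)) : conjq q (c *: B) = frobq qL c *: conjq q B.
Proof. by rewrite (conjqE cardL) map_mxZ. Qed.

(* Both sides are compared through their complex coordinates; the factor is
   (up to sign) the norm of [line s t] times [tangent s t], hence in F_q. *)
Let moment_A_aff s t : s \in Fq qL -> t \in Fq qL -> tangent s t != 0 ->
  (moment s t *m A == bb_aff q tau (cpt s t *m M))%MS.
Proof.
move=> sF tF tan0.
have st0 : (s != 0) || (t != 0).
  apply: contraNT tan0; rewrite negb_or !negbK => /andP[/eqP-> /eqP->].
  by rewrite /tangent !mul0r addr0.
have lin0 := lineN0 sF tF st0.
have aff : affine (cpt s t *m M) by rewrite /affine cpt_inf oppr_eq0 mulf_neq0.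
pose c := frobq qL (line s t) * (cpt s t *m M) ord0 (inord 2).
have cF : frobq qL c = c.
  rewrite /c cpt_inf !(rmorphM, rmorphN) /= (frobqK qL cardL).
  by rewrite (frobq_Fq (tangentF sF tF)); ring.
have c0 : c != 0 by rewrite mulf_neq0 ?fmorph_eq0.
apply/rV_eqmxP; exists c => //; have [mA mAc] := moment_A sF tF.
have cE : c * ((cpt s t *m M) ord0 (inord 2))^-1 = frobq qL (line s t).
  by rewrite mulfK.
apply: (eq_cplx tauN); first by rewrite mA -scalemxAl bb_aff_cplx // scalerA cE.
by rewrite mAc -scalemxAl bb_aff_cplx_conj // -[in RHS]cF -conjqZ scalerA cE.
Qed.

Let bb_affZ c P : c != 0 -> bb_aff q tau (c *: P) = bb_aff q tau P.
Proof.
move=> c0; have e x y : (c * x) / (c * y) = x / y by rewrite -mulf_div divff // mul1r.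
by rewrite /bb_aff !mxE !e.
Qed.

(** The curve point at the zero of [tangent]: the one point of the spread line that completes the
    affine points of the conic. *)
Let tangent_pt : 'rV[L]_5 := moment b02 (- b01) *m A.

(** Otherwise u0 would be a singular point of the conic. *)
Let b0N : (b02 != 0) || (- b01 != 0).
Proof.
rewrite oppr_eq0 -negb_and; apply: contraTN Runit => /andP[/eqP b2 /eqP b1].
rewrite unitmxE unitfE negbK det_mx3 /conic_mx -/b01 -/b02 b1 b2.
by rewrite !mxE !inordK //= !mxE !inordK //=; apply/eqP; ring.
Qed.

Let tangent0P s t : tangent s t = 0 -> exists e, s = e * b02 /\ t = e * - b01.
Proof.
move=> tan0; have [b2|b2] := eqVneq b02 0.
  have b1 : b01 != 0 by move: b0N; rewrite b2 eqxx oppr_eq0.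
  exists (- t / b01); split; last by field.
  by move/eqP: tan0; rewrite /tangent b2 !mulr0 addr0 mulf_eq0 (negPf b1) orbF => /eqP.
exists (s / b02); split; first by field.
by apply: (mulIf b2); rewrite -[LHS](addKr (s * b01)) -/(tangent s t) tan0; field.
Qed.

(** The zero of [tangent] yields [tangent_pt], every other parameter an affine conic point, and
    [conic_param] shows that all affine conic points arise. *)
Let nrc_bracket Y :
  nrc_pt q A Y <-> bracket_C_pt q tau M k tangent_pt Y.
Proof.
split=> [[Y0 [s [t [sF [tF mY]]]]]|[Y0 [[X [[X0 [v [vF [Qv vX]]]] [Xaff YX]]]|YP]]].
- split=> //; have [tan0|tan0] := eqVneq (tangent s t) 0.
    right; have [e [sE tE]] := tangent0P tan0.
    have e0 : e != 0.
      apply: contraNneq Y0 => e0; have := mY; rewrite sE tE momentZ e0 expr0n scale0r mul0mx.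
      by move=> /andP[_ /sub_rVP[d ->]]; rewrite scaler0.
    apply/eqmxP/(eqmx_trans (eqmx_sym (eqmxP mY))).
    by rewrite sE tE momentZ -scalemxAl; apply: eqmx_scale; rewrite expf_neq0.
  have st0 : (s != 0) || (t != 0).
    apply: contraNT tan0; rewrite negb_or !negbK => /andP[/eqP-> /eqP->].
    by rewrite /tangent !mul0r addr0.
  left; exists (cpt s t *m M); split; first exact: conic_cpt.
  split; first by rewrite /affine cpt_inf oppr_eq0 mulf_neq0 ?lineN0.
  apply/eqmxP/(eqmx_trans (eqmx_sym (eqmxP mY)))/eqmxP; exact: moment_A_aff.
- have /rV_eqmxP[d d0 vE] := vX.
  have vaff : (v *m M) ord0 (inord 2) != 0 by rewrite vE mxE mulf_neq0.
  have [s [t [sF tF tan0 cE]]] := conic_param vF Qv vaff.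
  split=> //; exists s, t; split=> //; split=> //.
  apply/eqmxP/(eqmx_trans _ (eqmx_sym (eqmxP YX))).
  have := moment_A_aff sF tF tan0.
  by rewrite cE -scalemxAl vE !bb_affZ ?oppr_eq0 // => /eqmxP.
- split=> //; exists b02, (- b01); split; first exact: b02F.
  split; first by rewrite -[inFq _ _]/(_ \in Fq qL) rpredN.
  by apply/eqmxP/eqmx_sym/eqmxP.
Qed.

Let tangent_pt_spread T : on_linf T -> (u 0%N *m M == T)%MS ->
  spread_pt q tau T tangent_pt.
Proof.
move=> /andP[T0 /eqP T2] /rV_eqmxP[mu mu0 uE].
have b1F : - b01 \in Fq qL by rewrite rpredN.
have m0 : moment b02 (- b01) != 0 by rewrite moment_eq0 negb_and.
split; first by rewrite row_free_mul_eq0.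
have tan0 : tangent b02 (- b01) = 0 by rewrite /tangent; ring.
have cE : cpt b02 (- b01) = Qform k (pt b02 (- b01)) *: u 0%N.
  by rewrite cptE tan0 scale0r subr0.
have Q0 : Qform k (pt b02 (- b01)) != 0.
  apply: contraTneq b0N => Q0; rewrite -negb_and negbK -cpt_eq0 cE Q0 scale0r.
  by [].
have [mA mAc] := moment_A b02F b1F.
(* The three factors come from the scaling in [W], from [cpt] being Q(w) u0 at this parameter, and
   from the choice of representative of T. *)
pose lam := frobq qL (line b02 (- b01)) * Qform k (pt b02 (- b01)) * mu.
exists lam; split; first by rewrite !mulf_neq0 ?fmorph_eq0 ?lineN0.
have lamT : frobq qL (line b02 (- b01)) *: (cpt b02 (- b01) *m M) =
    row3 (lam * T ord0 (inord 0)) (lam * T ord0 (inord 1)) 0.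
  rewrite cE -scalemxAl uE !scalerA; apply/rowP; apply: ord3P;
    by rewrite !mxE !inordK //= T2 mulr0.
suff -> : tangent_pt = bbdir q tau (lam * T ord0 (inord 0)) (lam * T ord0 (inord 1)).
  by rewrite !submx_refl.
apply: (eq_cplx tauN); first by rewrite mA lamT bbdir_cplx.
rewrite mAc lamT bbdir_cplx_conj // (conjqE cardL); apply/rowP; apply: ord3P;
  by rewrite !mxE !inordK //= rmorph0.
Qed.

Let conjq_cplx a : conjq q (cplx a) = cplx (a ^+ q) :> 'M[L]_(5, 3).
Proof.
rewrite (conjqE cardL); apply/matrixP => i j; rewrite mxE.
by elim/ord5P: i; elim/ord3P: j; rewrite !mxE !inordK //= ?rmorph0 ?rmorph1.
Qed.

(** Conjugation exchanges the kernels of [cplx tau] and [cplx (tau ^+ q)], so [G] and its conjugate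
    are these two lines in some order. The curve meets them at the zeros of alpha^q s + beta^q t and
    of [line] respectively. *)
Let bbmx_g_special G : spread_transversal q tau G -> g_special q A G.
Proof.
move=> /(spread_transversal_ker cardL tauN)[rG Gker].
have rcG : \rank (conjq q G) = 2%N by rewrite (conjqE cardL) mxrank_map.
have ab0 : (alpha != 0) || (beta != 0).
  have := @lineN0 1 0 (rpred1 _) (rpred0 _); rewrite oner_eq0 => /(_ isT).
  by rewrite /line mulr0 addr0 mulr1 => ->.
have ab0c : (frobq qL alpha != 0) || (frobq qL beta != 0) by rewrite !fmorph_eq0.
have Hcunit : conjq q H \in unitmx by rewrite (conjqE cardL) map_unitmx.
have conjG a : G *m cplx a = 0 -> conjq q G *m cplx (a ^+ q) = 0.
  by move=> G0; rewrite -conjq_cplx -(conjqM cardL) G0 (conjqE cardL) map_mx0.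
have on_tau := meets_ker_cplx A_free Hunit ab0c A_cplx.
have on_tauc := meets_ker_cplx A_free Hcunit ab0 A_cplx_conj.
case: Gker => G0; split.
- exact: on_tau.
- by apply: on_tauc => //; apply: conjG.
- exact: on_tauc.
- by apply: on_tau => //; rewrite -[tau](frobqK qL cardL); apply: conjG.
Qed.

Lemma conic_twisted_cubic (T : 'rV[L]_3) : on_linf T ->
    (row (inord 0) N *m M == T)%MS ->
  exists (P0 : 'rV[L]_5) (B : 'M[L]_(4, 5)),
    [/\ spread_pt q tau T P0, twisted_cubic_param q B,
        forall Y, nrc_pt q B Y <-> bracket_C_pt q tau M k P0 Y &
        forall G, spread_transversal q tau G -> g_special q B G].
Proof.
move=> Tinf uT; exists tangent_pt, A; split.
- exact: tangent_pt_spread.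
- by [].
- exact: nrc_bracket.
- exact: bbmx_g_special.
Qed.

End ConicCubic.

(** * Choice of a basis adapted to T, and passage to an arbitrary parametrization *)

Theorem theorem5p5 (L : finFieldType) (q : nat) (tau : L)
    (M : 'M[L]_3) (k : 'rV[L]_6) (T : 'rV[L]_3) :
  (5 < q)%N -> #|L| = (q ^ 2)%N -> tau ^+ q != tau ->
  M \in unitmx ->
  baer_tangent_at q M T ->
  nondeg_Fq_form q k ->
  conic_pt q M k T ->
  exists P0 : 'rV[L]_5,
    spread_pt q tau T P0 /\
    (exists A, twisted_cubic_param q A /\
       forall Y, nrc_pt q A Y <-> bracket_C_pt q tau M k P0 Y) /\
    (forall A, twisted_cubic_param q A ->
       (forall Y, nrc_pt q A Y <-> bracket_C_pt q tau M k P0 Y) ->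
       forall G, spread_transversal q tau G -> g_special q A G).
Proof.
move=> q5 cardL tauN Munit [_ [Tinf Tuniq]] [kF kdisc] [T0 [v [vF [Qv vT]]]].
have v0 : v != 0.
  apply: contraNneq T0 => v0; move: vT; rewrite v0 mul0mx => /andP[_].
  by move=> /sub_rVP[c ->]; rewrite scaler0.
have [N [Nunit NF N0]] := complete_Fq_basis cardL v0 vF.
pose qL := sqrt_card_pchar cardL; pose u i := row (inord i) N.
have vM2 : (v *m M) ord0 (inord 2) = 0.
  have /andP[/sub_rVP[c ->] _] := vT; case/andP: Tinf => _ /eqP T2.
  by rewrite mxE T2 mulr0.
(* A zero would give a Baer point at infinity on the join of u1 and u2; by tangency it equals T, the
   image of u0, against independence of the basis. *)
have lineN0 s t : s \in Fq qL -> t \in Fq qL -> (s != 0) || (t != 0) ->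
    (u 1%N *m M) ord0 (inord 2) * s + (u 2%N *m M) ord0 (inord 2) * t != 0.
  move=> sF tF st0; pose x := row3 0 s t.
  have xF : Fq_mx q (x *m N).
    apply/(Fq_mxE cardL); rewrite (conjqM cardL).
    congr (_ *m _); last exact/(Fq_mxE cardL).
    apply/(Fq_mxE cardL)/(Fq_mxP cardL) => i.
    by apply: ord3P; rewrite mxE inordK //= rpred0.
  have xE : x *m N = s *: u 1%N + t *: u 2%N.
    by rewrite mulmx_sum_row sum_ord3 !mxE !inordK //= scale0r add0r.
  have x0 : x != 0.
    apply: contraTneq st0 => /rowP x0; have := x0 (inord 1); have := x0 (inord 2).
    by rewrite !mxE !inordK //= => -> ->; rewrite eqxx.
  have xNM0 : x *m N *m M != 0 by rewrite !row_free_mul_eq0 ?row_free_unit.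
  apply/eqP => line0.
  have xinf : on_linf (x *m N *m M).
    have coord (y z : 'rV[L]_3) : (s *: y + t *: z) ord0 (inord 2) =
        y ord0 (inord 2) * s + z ord0 (inord 2) * t.
      by rewrite !mxE mulrC [t * _]mulrC.
    by rewrite /on_linf xNM0 xE mulmxDl -!scalemxAl coord line0 eqxx.
  have xpt : baer_pt q M (x *m N *m M).
    by split=> //; exists (x *m N); rewrite !submx_refl.
  have /eqmxP xT := Tuniq _ xpt xinf; have /eqmxP vT' := vT.
  have /andP[/sub_rVP[c xc] _] : (x *m N *m M == v *m M)%MS.
    by apply/eqmxP/(eqmx_trans xT)/eqmx_sym.
  have {}xc : x = c *: delta_mx 0 (inord 0).
    have freeM : row_free M by rewrite row_free_unit.
    have freeN : row_free N by rewrite row_free_unit.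
    apply: (row_free_inj freeN); apply: (row_free_inj freeM).
    by rewrite xc -N0 rowE -!scalemxAl.
  move/rowP in xc.
  have := xc (inord 1); have := xc (inord 2).
  rewrite !mxE -!val_eqE /= !inordK //= !mulr0 => t0 s0.
  by move: st0; rewrite s0 t0 eqxx.
rewrite -N0 in Qv vM2 vT.
have [P0 [B [P0T [BF Bfree] BY Bg]]] := conic_twisted_cubic tauN Munit kF
  kdisc Nunit NF Qv vM2 lineN0 Tinf vT.
exists P0; split=> //; split; first by exists B.
(* Any other parametrization has the same F_q-points as [B], hence the same extension. *)
move=> A [AF Afree] AY G /Bg; apply: (g_special_transfer cardL tauN q5 Bfree Afree).
by move=> Y; rewrite BY AY.
Qed.
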